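(* Let $T=(V,E,w)$ be a weighted tree, let $i,j\in V$ be fixed with $i\ne j$, and let $\alpha\in[0,1)$. For $x\sim i$ write $\sigma_{ix}=-1$ if the edge $\{i,x\}$ is on the geodesic $P^\ast_{ij}$ and $\sigma_{ix}=1$ otherwise; similarly for $y\sim j$ write $\sigma_{jy}=-1$ if $\{j,y\}$ is on $P^\ast_{ij}$ and $\sigma_{jy}=1$ otherwise. Then the Ollivier-Ricci curvature $\kappa^{\mathsf{or},\alpha}_{ij}$ is given as follows. If $\{i,j\}\in E$ and $\alpha\in[0,1/2)$, then $$\kappa^{\mathsf{or},\alpha}_{ij}=1-\sum_{\substack{x\sim i\\ x\ne j}}\frac{w_{ix}(1-\alpha)}{\mathrm{d}_w(i)}-\sum_{\substack{y\sim j\\ y\ne i}}\frac{w_{jy}(1-\alpha)}{\mathrm{d}_w(j)}-\left|1-(1-\alpha)w_{ij}\left(\frac{1}{\mathrm{d}_w(i)}+\frac{1}{\mathrm{d}_w(j)}\right)\right|.$$ If $\{i,j\}\in E$ and $\alpha\ge 1/2$, then $$\kappa^{\mathsf{or},\alpha}_{ij}=-(1-\alpha)\left(\sum_{x\sim i}\frac{w_{ix}\sigma_{ix}}{\mathrm{d}_w(i)}+\sum_{y\sim j}\frac{w_{jy}\sigma_{jy}}{\mathrm{d}_w(j)}\right).$$ If $i\nsim j$, then $$\kappa^{\mathsf{or},\alpha}_{ij}=-\frac{1-\alpha}{\Delta(i,j)}\left(\sum_{x\sim i}\frac{w_{ix}\sigma_{ix}}{\mathrm{d}_w(i)}+\sum_{y\sim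 j}\frac{w_{jy}\sigma_{jy}}{\mathrm{d}_w(j)}\right).$$
   Context: A tree is a finite, simple, connected, acyclic graph; a weighted tree $T=(V,E,w)$ has $V=\{1,\dots,n\}$ and strictly positive edge weights $w_{ij}=w_{ji}$ for $\{i,j\}\in E$. Write $i\sim j$ if $\{i,j\}\in E$. The weighted degree is $\mathrm{d}_w(i)=\sum_{x\sim i}w_{ix}$. $\Delta(i,j)$ is the unweighted shortest path distance (number of edges in a shortest path), and $P^\ast_{ij}$, the geodesic, is the unique shortest path from $i$ to $j$. For $\alpha\in[0,1)$ and $i\in V$, the $\alpha$-lazy random walk measure $m_i^{(\alpha)}$ is the probability measure on $V$ with $m_i^{(\alpha)}(i)=\alpha$, $m_i^{(\alpha)}(x)=(1-\alpha)w_{ix}/\mathrm{d}_w(i)$ if $x\sim i$, and $m_i^{(\alpha)}(x)=0$ otherwise. For probability measures $\mu,\nu$ on $V$, $$\mathsf{W}_1(\mu,\nu)=\inf\Big\{\sum_{i,j\in V}\pi_{ij}\Delta(i,j):\ \pi\in\mathbb{R}^{n\times n},\ \pi_{ij}\ge 0,\ \mathbf{1}^T\pi=\mu^T,\ \pi\mathbf{1}=\nu\Big\},$$ where $\mathbf 1$ is the all-ones vector. The Ollivier-Ricci curvature is $\kappa^{\mathsf{or},\alpha}_{ij}=1-\mathsf{W}_1(m_i^{(\alpha)},m_j^{(\alpha)})/\Delta(i,j)$ for $i\neq j$. *)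

(* Defs.v *)
From mathcomp Require Import all_boot all_order all_algebra.
From mathcomp Require Import all_classical all_reals.

Set Implicit Arguments.
Unset Strict Implicit.
Unset Printing Implicit Defensive.

Import Order.TTheory GRing.Theory Num.Theory.
Local Open Scope ring_scope.

(* Weights are constrained on edges only; the other values [wgt i j] are
   never used.  [ucycle] also accepts [:: x; y] for an edge {x, y}, hence the
   size condition in [adj_acyclic]. *)
Record wtree (R : realType) (n : nat) := WTree {
  adj : rel 'I_n;
  wgt : 'I_n -> 'I_n -> R;
  adj_sym : symmetric adj;
  adj_irr : irreflexive adj;
  adj_connected : forall i j, connect adj i j;
  adj_acyclic : forall c : seq 'I_n, ucycle adj c -> (size c <= 2)%N;
  wgt_sym : forall i j, adj i j -> wgt i j = wgt j i;
  wgt_gt0 : forall i j, adj i j -> 0 < wgt i j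
}.

Section Curvature.
Variables (R : realType) (n : nat) (T : wtree R n).
Implicit Types (i j x a b : 'I_n) (k : nat) (alpha : R).

Definition wdeg i : R := \sum_(x | adj T i x) wgt T i x.

(* As usual for [path], the initial vertex [i] is not listed in [p], so
   that the size [k] of [p] is the number of edges. *)
Definition is_walk i j k (p : k.-tuple 'I_n) : bool :=
  path (adj T) i p && (last i p == j).

Lemma walk_exists i j : exists k, [exists p : k.-tuple 'I_n, is_walk i j p].
Proof.
have /connectP [p pP ->] := adj_connected T i j.
by exists (size p); apply/existsP; exists (in_tuple p); rewrite /is_walk pP /=.
Qed.

Definition dist i j : nat := ex_minn (walk_exists i j).

Lemma geodesic_exists i j : exists p : (dist i j).-tuple 'I_n, is_walk i j p.
Proof. by rewrite /dist; case: ex_minnP => k /existsP. Qed.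

(* In a tree there is exactly one walk with [dist i j] edges, so that the
   choice made by [xchoose] is immaterial. *)
Definition geodesic i j : seq 'I_n := i :: xchoose (geodesic_exists i j).

Definition on_geodesic i j a b : bool :=
  infix [:: a; b] (geodesic i j) || infix [:: b; a] (geodesic i j).

Definition sigma i j a b : R := if on_geodesic i j a b then -1 else 1.

Definition lazy_walk alpha i : 'cV[R]_n :=
  \col_x (if x == i then alpha
          else if adj T i x then (1 - alpha) * wgt T i x / wdeg i
          else 0).

Definition coupling (mu nu : 'cV[R]_n) : set 'M[R]_n :=
  [set P : 'M[R]_n | (forall i j, 0 <= P i j) /\
           (const_mx 1 : 'cV[R]_n)^T *m P = mu^T /\
           P *m (const_mx 1 : 'cV[R]_n) = nu]%classic.

Definition W1 (mu nu : 'cV[R]_n) : R :=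
  inf [set \sum_i \sum_j P i j * (dist i j)%:R | P in coupling mu nu]%classic.

(* Only meaningful for [i != j]. *)
Definition or_curvature alpha i j : R :=
  1 - W1 (lazy_walk alpha i) (lazy_walk alpha j) / (dist i j)%:R.

End Curvature.

(* Main.v *)
Require Import Defs.
From mathcomp Require Import all_boot all_order all_algebra.
From mathcomp Require Import all_classical all_reals.
From mathcomp Require Import zify ring lra.

Set Implicit Arguments.
Unset Strict Implicit.
Unset Printing Implicit Defensive.

Import Order.TTheory GRing.Theory Num.Theory.
Local Open Scope ring_scope.

(** Write D for the distance from i to j, m_i and m_j for the two lazy walk
    measures, and N[v] for a vertex v together with its neighbors.  In a tree,
    the geodesic from a point b of N[i] to a point a of N[j] passes through i
    and j, except that it may skip i or j when it starts or ends on the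
    geodesic between them.  In all cases

      d(a, b) = d(b, j) + d(a, i) - D,

    with the single exception of adjacent i and j with b = j and a = i, where
    the right-hand side is -1 instead of 1 ([dist_neighborhoods]).  So the
    cost is a function of b plus a function of a, plus 2 at one single entry
    when i ~ j.  The separated part contributes the same amount to the cost of
    every coupling, namely E_{m_i} d(., j) + E_{m_j} d(., i) - D, and only
    the mass P(i, j) that the coupling P puts on that entry remains to be
    minimized.

    The least mass that a coupling of mu and nu can put on one entry is the
    Frechet bound max(0, p + q - 1), where p and q are the masses of the
    corresponding atoms ([coupling_entry_ge], [coupling_entry_min]).  Hence
    the exact value of W_1 in all cases at once ([W1_lazy_walk]):

      W_1 = D + (1 - alpha) S + 2 [i ~ j] max(0, m_i(j) + m_j(i) - 1),

    S being the sum of the two sigma-weighted sums of the theorem, because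
    d(x, j) = D + sigma_{ix} for x ~ i ([dist_neighbor_sigma]).  For i and j
    not adjacent the last term is absent; for i ~ j and alpha >= 1/2 it
    vanishes because m_i(j) and m_j(i) are at most 1 - alpha; for alpha < 1/2
    it combines with the contribution -m_i(j) - m_j(i) of the edge {i, j} to S
    through t + 2 max(0, -t) = |t|, where t = 1 - m_i(j) - m_j(i).

    The tree metric facts all come from one consequence of acyclicity: among
    the neighbors of i, at most one is not strictly farther from j than i is
    ([other_neighbors_farther]). *)

(** * The metric of a tree *)

Section TreeMetric.
Variables (R : realType) (n : nat) (T : wtree R n).
Implicit Types (i j x y z a b : 'I_n) (p q : seq 'I_n).

Local Notation d := (dist T).

Lemma dist_le_size i p : path (adj T) i p -> (d i (last i p) <= size p)%N.
Proof.
move=> pP; rewrite /dist; case: ex_minnP => m _; apply.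
by apply/existsP; exists (in_tuple p); rewrite /is_walk pP /=.
Qed.

Lemma shortest_walk i j :
  exists2 p, path (adj T) i p & last i p = j /\ size p = d i j.
Proof.
have [p /andP[pP /eqP pl]] := geodesic_exists T i j.
by exists p; rewrite ?size_tuple.
Qed.

Lemma dist_triangle j i k : (d i k <= d i j + d j k)%N.
Proof.
have [p pP [<- <-]] := shortest_walk i j.
have [q qP [<- <-]] := shortest_walk (last i p) k.
by rewrite -last_cat -size_cat dist_le_size // cat_path pP.
Qed.

Lemma distC i j : d i j = d j i.
Proof.
suff le k l : (d k l <= d l k)%N by apply/eqP; rewrite eqn_leq !le.
have [p pP [pl <-]] := shortest_walk l k; subst k.
have rP : path (adj T) (last l p) (rev (belast l p)).
  by rewrite rev_path; apply: sub_path pP => u v; rewrite /= adj_sym.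
have := dist_le_size rP; rewrite size_rev size_belast.
by case: p {pP rP} => [|u p] //=; rewrite rev_cons last_rcons.
Qed.

Lemma distii i : d i i = 0.
Proof. by apply/eqP; rewrite -leqn0; apply: (@dist_le_size i [::]). Qed.

Lemma dist_eq0 i j : (d i j == 0)%N = (i == j).
Proof.
apply/eqP/eqP => [|->]; last exact: distii.
by have [[|u p] _ [/= ij <-]] := shortest_walk i j.
Qed.

Lemma dist_adj i j : adj T i j -> d i j = 1%N.
Proof.
move=> ij; have := @dist_le_size i [:: j]; rewrite /= ij => /(_ isT).
have := dist_eq0 i j; case: (eqVneq i j) => [ijE|_]; last lia.
by rewrite ijE adj_irr in ij.
Qed.

Lemma closer_neighbor i j : i != j ->
  exists2 z, adj T i z & d i j = (d z j).+1.
Proof.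
move=> ij; have [[|z p] /= pP [pl ps]] := shortest_walk i j.
  by rewrite pl eqxx in ij.
case/andP: pP => iz pP; exists z => //.
have := dist_le_size pP; have := dist_triangle z i j.
rewrite pl (dist_adj iz) -ps add1n ltnS => le ge.
by apply/eqP; rewrite eqSS eqn_leq le.
Qed.

(** Deleting a vertex of a tree disconnects its neighbors from each other: a
    simple path between two of them that avoids [i] closes up through [i] to
    a cycle with at least three vertices. *)
Lemma neighbors_separated i x y : adj T i x -> adj T i y -> x != y ->
  ~~ connect [rel u v | [&& adj T u v, u != i & v != i]] x y.
Proof.
move=> ix iy; apply: contra => /connectP[p0 p0P yE].
subst y; case/shortenP: p0P iy => p pP pU _ iy.
have pA : path (adj T) x p.
  by apply: sub_path pP => u v /and3P[].
have iNp : i \notin x :: p.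
  have xi : x != i by apply: contraTneq ix => ->; rewrite adj_irr.
  elim: p x xi pP {ix pU iy pA p0} => [|v p IH] u ui /=.
    by rewrite inE eq_sym ui.
  by case/andP=> /and3P[_ _ vi] /(IH v vi) iN; rewrite inE eq_sym negb_or ui.
have /adj_acyclic : ucycle (adj T) (i :: x :: p).
  rewrite /ucycle cons_uniq iNp pU /= ix rcons_path pA /=.
  by rewrite adj_sym iy.
by case: p {pP pU iy pA iNp} => //=.
Qed.

(** If neither [x] nor [y] were farther from [j] than [i] is, shortest walks
    from them to [j] would avoid [i], since passing through [i] costs at least
    one more step; together they would join [x] to [y] without meeting [i]. *)
Lemma other_neighbors_farther i j x y : adj T i x -> adj T i y -> x != y ->
  (d x j <= d i j)%N -> d y j = (d i j).+1.
Proof.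
move=> ix iy xy xj.
have yle : (d y j <= (d i j).+1)%N.
  by rewrite -add1n -(dist_adj iy) [d i y]distC dist_triangle.
apply/eqP; rewrite eqn_leq yle /= leqNgt; apply/negP; rewrite ltnS => yj.
set e := [rel u v | [&& adj T u v, u != i & v != i]].
have avoid z : adj T i z -> (d z j <= d i j)%N -> connect e z j.
  move=> iz zj; have [p pP [pl pz]] := shortest_walk z j.
  have iNp : i \notin z :: p.
    rewrite inE negb_or; apply/andP; split.
      by apply: contraTneq iz => ->; rewrite adj_irr.
    apply/negP => /splitPr ip; case: ip pP pl pz => p1 p2.
    rewrite cat_path last_cat /= size_cat /= => /and3P[_ _ p2P] p2l.
    by have := dist_le_size p2P; rewrite p2l; lia.
  apply/connectP; exists p => //.
  have pA : all (predC1 i) (z :: p).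
    by apply/allP => u uP /=; apply: contraNneq iNp => <-.
  apply: sub_in_path pA pP => u v.
  by rewrite !inE => ui vi uv; rewrite /= uv ui vi.
have := neighbors_separated ix iy xy; rewrite -/e => /negP; apply.
have eC : connect_sym e.
  by apply: sym_connect_sym => u v /=; rewrite adj_sym [(u != i) && _]andbC.
by rewrite (connect_trans (avoid x ix xj)) // eC avoid.
Qed.

(** The neighbor of [i] towards [j] is one step closer to [j], and all the
    others are one step farther. *)
Lemma dist_adjS i x j : adj T i x ->
  d x j = (d i j).+1 \/ d i j = (d x j).+1.
Proof.
move=> ix; have [<-|ij] := eqVneq i j.
  by left; rewrite distii distC dist_adj.
have [z iz zE] := closer_neighbor ij.
have [->|zx] := eqVneq x z; first by right.
by left; apply: (@other_neighbors_farther _ _ z); rewrite ?zE // eq_sym.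
Qed.

(** Only one neighbor of [i] is closer to the end of the walks, so both walks
    must start with it. *)
Lemma shortest_walk_unique i p q :
  path (adj T) i p -> path (adj T) i q -> last i p = last i q ->
  size p = d i (last i p) -> size q = d i (last i p) -> p = q.
Proof.
elim: p i q => [|x p IH] i [|y q] //=; [by move=> _ _ _ <-|by move=> _ _ _ <-|].
move=> /andP[ix pP] /andP[iy qP] l sp sq.
have xE := dist_le_size pP; have yE := dist_le_size qP.
have xy : x = y.
  apply/eqP/negPn/negP => xy.
  have := @other_neighbors_farther i (last x p) x y ix iy xy.
  by rewrite l in sp sq xE *; lia.
subst y; have := dist_adjS (last x p) ix => xd.
by congr (_ :: _); apply: (IH x) => //; rewrite -?l in yE *; lia.
Qed.

(** By uniqueness of shortest walks, an oriented edge is traversed by the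
    geodesic exactly when going through it costs no extra step.  This turns
    membership in the chosen geodesic into a statement about distances. *)
Lemma infix_geodesic i j a b : adj T a b ->
  infix [:: a; b] (geodesic T i j) = ((d i a).+1 + d b j == d i j)%N.
Proof.
rewrite /geodesic; move: (xchooseP (geodesic_exists T i j)).
move: (xchoose _) => t; move: (size_tuple t); rewrite /is_walk.
move: (tval t) => p ps /andP[pP /eqP pl] ab.
have tri1 := dist_triangle a i j; have tri2 := dist_triangle b a j.
rewrite (dist_adj ab) in tri2.
apply/infixP/eqP => [[s [s' E]]|E]; last first.
  have [q qP [ql qs]] := shortest_walk i a.
  have [r rP [rl rs]] := shortest_walk b j.
  have -> : p = q ++ b :: r.
    apply: (@shortest_walk_unique i) => //; rewrite ?pl ?last_cat //=.
      by rewrite cat_path qP /= ql ab.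
    by rewrite size_cat /= qs rs -E; lia.
  have : exists s, i :: q = rcons s a.
    by exists (belast i q); rewrite -ql -lastI.
  by case=> s sE; exists s, r; rewrite -cat_cons sE cat_rcons.
apply/eqP; rewrite eqn_leq; apply/andP; split; last by lia.
have {}E : exists q, i :: q = rcons s a /\ p = q ++ b :: s'.
  case: s E => [|u s] [-> E]; first by exists [::].
  by exists (rcons s a); rewrite E cat_rcons.
case: E => q [qE pE]; move: pP pl ps; rewrite pE cat_path last_cat size_cat /=.
have -> : last i q = a by rewrite -[RHS](last_rcons i s) -qE.
case/and3P=> qP _ s'P s'l.
have := dist_le_size qP; have := dist_le_size s'P; rewrite s'l.
have -> : last i q = a by rewrite -[RHS](last_rcons i s) -qE.
by lia.
Qed.

Lemma dist_neighbor_sigma i j x : adj T i x ->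
  (d x j)%:R = (d i j)%:R + sigma T i j i x.
Proof.
move=> ix; rewrite /sigma /on_geodesic !infix_geodesic ?[adj T x i]adj_sym //.
rewrite distii; have xd := dist_adjS j ix.
case: ifP => E.
  have -> : d i j = (d x j).+1 by lia.
  by rewrite -natr1; ring.
have -> : d x j = (d i j).+1 by lia.
by rewrite -natr1.
Qed.

Lemma sigmaC i j a b : adj T a b -> sigma T i j a b = sigma T j i a b.
Proof.
move=> ab; rewrite /sigma /on_geodesic !infix_geodesic ?[adj T b a]adj_sym //.
rewrite (distC i a) (distC i b) (distC b j) (distC a j) (distC i j).
rewrite !addSn (addnC (d b i)) (addnC (d a i)) orbC.
congr (if _ || _ then _ else _).
Qed.

(** The exceptional term is there because the geodesic from [j] to [i] has
    one edge, while cutting the edge {i, j} from both of its ends would give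
    it length -1. *)
Lemma dist_neighborhoods i j a b : i != j ->
  (b == i) || adj T i b -> (a == j) || adj T j a ->
  (d a b + d i j = d b j + d a i
     + 2 * [&& adj T i j, a == i & b == j])%N.
Proof.
move=> ij.
have corr0 : a = j \/ b = i -> [&& adj T i j, a == i & b == j] = false.
  by case=> ->; rewrite ?[j == i]eq_sym (negbTE ij) ?andbF.
have [bi _ _|_ /=] := eqVneq b i; first by rewrite corr0; [subst b; lia|right].
have [aj _|_ /=] := eqVneq a j.
  by rewrite corr0; [subst a; rewrite (distC j b) (distC j i); lia|left].
move=> ib ja.
have h1 := dist_adjS j ib; have h2 := dist_adjS i ja.
have h3 := dist_adjS a ib; have h4 := dist_adjS b ja.
rewrite ![d j _]distC ![d a _]distC in h1 h2 h3 h4 *.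
have ia : d a i = d i a := distC a i.
case: h1 => [bj|bj]; case: h2 => [ai|ai].
- (* {i, b} and {j, a} both lead away from the geodesic.  The neighbor z of
     i towards j is at distance at most d i j from a, hence closer to a than
     i is, so the other neighbor b is farther. *)
  have [z iz jz] := closer_neighbor ij.
  have zb : z != b by apply: contra_eq_neq bj => <-; lia.
  have za := dist_triangle j z a; rewrite (dist_adj ja) in za.
  have := @other_neighbors_farther i a z b iz ib zb.
  have -> : [&& adj T i j, a == i & b == j] = false.
    by apply: contra_eqF bj => /and3P[_ _ /eqP->]; rewrite distii.
  by lia.
- have -> : [&& adj T i j, a == i & b == j] = false.
    by apply: contra_eqF bj => /and3P[_ _ /eqP->]; rewrite distii.
  by lia.
- have -> : [&& adj T i j, a == i & b == j] = false.
    by apply: contra_eqF ai => /and3P[_ /eqP-> _]; rewrite distii.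
  by lia.
have [jbE|jb0] := eqVneq j b.
  subst b; rewrite distii in bj; rewrite ib.
  have -> : a == i by rewrite -dist_eq0; lia.
  by have := distii j; have := dist_eq0 a i; lia.
(* Both edges lie on a geodesic with at least two edges.  The neighbor y of
   j towards b is also its neighbor towards i, which is a; so a is closer to
   b than j is. *)
rewrite !andbF; suff : d b a != (d b j).+1 by lia.
apply/eqP => ba.
have [y jy yb] := closer_neighbor jb0.
have yb' : y != a.
  by apply/eqP => ya; subst y; have := distC a b; have := distC j b; lia.
have jy1 := dist_triangle b i y; rewrite (dist_adj ib) in jy1.
have := @other_neighbors_farther j i y a jy ja yb'.
rewrite [d j b]distC in yb; rewrite [d j i]distC (distC y i).
by have := distC b y; lia.
Qed.

End TreeMetric.

(** * The least mass that a coupling can put on one entry *)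

Section FrechetBound.
Variables (R : realType) (n : nat).
Implicit Types (mu nu : 'cV[R]_n) (P : 'M[R]_n) (a b : 'I_n).

Definition prob_vec mu := (forall b, 0 <= mu b 0) /\ \sum_b mu b 0 = 1.

(** The column index of a coupling is the one distributed as [mu], and its
    row index the one distributed as [nu]. *)
Lemma couplingP mu nu P : coupling mu nu P <->
  [/\ forall a b, 0 <= P a b, forall b, \sum_a P a b = mu b 0
    & forall a, \sum_b P a b = nu a 0].
Proof.
have colE b : ((const_mx 1 : 'cV[R]_n)^T *m P) 0 b = \sum_a P a b.
  by rewrite mxE; apply: eq_bigr => a _; rewrite !mxE mul1r.
have rowE a : (P *m (const_mx 1 : 'cV[R]_n)) a 0 = \sum_b P a b.
  by rewrite mxE; apply: eq_bigr => b _; rewrite !mxE mulr1.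
split=> [[P0 [Pc Pr]]|[P0 Pc Pr]].
  by split=> // [b|a]; rewrite -?colE -?rowE ?Pc ?Pr // mxE.
split=> //; split; first by apply/rowP => b; rewrite colE Pc mxE.
by apply/colP => a; rewrite rowE Pr.
Qed.

Lemma coupling_supp mu nu P a b : coupling mu nu P ->
  P a b != 0 -> mu b 0 != 0 /\ nu a 0 != 0.
Proof.
move=> /couplingP[P0 Pc Pr] Pab.
have Pab0 : 0 < P a b by rewrite lt_def Pab P0.
by split; rewrite gt_eqF // -?Pc -?Pr (lt_le_trans Pab0) //;
   [rewrite (bigD1 a)|rewrite (bigD1 b)] => //=; rewrite lerDl sumr_ge0.
Qed.

Lemma prob_vec_le1 mu b : prob_vec mu -> mu b 0 <= 1.
Proof.
by move=> [mu0 <-]; rewrite (bigD1 b) //= lerDl sumr_ge0.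
Qed.

(** The mass that column [b0] cannot place in row [a0] must fit into the other
    rows, which hold only [1 - nu a0 0]. *)
Lemma coupling_entry_ge mu nu P a0 b0 : prob_vec nu ->
  coupling mu nu P -> Num.max 0 (mu b0 0 + nu a0 0 - 1) <= P a0 b0.
Proof.
move=> [_ nu1] /couplingP[P0 Pc Pr]; rewrite ge_max P0 /=.
rewrite -Pc (bigD1 a0) //= -nu1 [X in _ - X](bigD1 a0) //=.
have : \sum_(a | a != a0) P a b0 <= \sum_(a | a != a0) nu a 0.
  by apply: ler_sum => a _; rewrite -Pr (bigD1 b0) //= lerDl sumr_ge0.
by lra.
Qed.

(** The Frechet bound is attained by a rank one perturbation of the product
    coupling, nu mu^T - r (delta_{a0} - nu) (delta_{b0} - mu)^T.  The
    perturbation has zero row and column sums, so the marginals are right for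
    every [r], and all entries but the one at [(a0, b0)] are nonnegative when
    [r] is in [0, 1].  That entry is p q - r (1 - p) (1 - q): it equals
    p + q - 1 for [r = 1], and 0 for r = p q / ((1 - p) (1 - q)), which is at
    most 1 exactly when p + q <= 1. *)
Lemma coupling_entry_min mu nu a0 b0 : prob_vec mu -> prob_vec nu ->
  exists2 P, coupling mu nu P & P a0 b0 = Num.max 0 (mu b0 0 + nu a0 0 - 1).
Proof.
move=> Hmu Hnu; have [mu0 mu1] := Hmu; have [nu0 nu1] := Hnu.
set p := mu b0 0; set q := nu a0 0.
have p1 : p <= 1 := prob_vec_le1 b0 Hmu.
have q1 : q <= 1 := prob_vec_le1 a0 Hnu.
have p0 : 0 <= p := mu0 b0; have q0 : 0 <= q := nu0 a0.
have [r [r0 r1 rE]] : exists r, [/\ 0 <= r, r <= 1 &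
    p * q - r * ((1 - p) * (1 - q)) = Num.max 0 (p + q - 1)].
  have [pq|pq] := leP (p + q) 1; last first.
    by exists 1; split; rewrite ?ler01 // max_r; lra.
  (* As p + q <= 1, if one of p and q is 1 then the other is 0, and the
     product coupling already vanishes at (a0, b0). *)
  have [z|nz] := eqVneq ((1 - p) * (1 - q)) 0.
    exists 0; split; rewrite ?ler01 //= max_l; last by lra.
    by move/eqP: z; rewrite mulf_eq0 => /orP[]/eqP z; nra.
  have pos : 0 < (1 - p) * (1 - q) by rewrite lt_def nz mulr_ge0 ?subr_ge0.
  exists (p * q / ((1 - p) * (1 - q))); split.
  - by rewrite divr_ge0 ?mulr_ge0 ?subr_ge0.
  - by rewrite ler_pdivrMr // mul1r; lra.
  - by rewrite divfK // subrr max_l //; lra.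
pose P : 'M[R]_n := \matrix_(a, b)
  (nu a 0 * mu b 0 - r * (((a == a0)%:R - nu a 0) * ((b == b0)%:R - mu b 0))).
have delta1 (c : 'I_n) : \sum_a (a == c)%:R = 1 :> R.
  by rewrite (bigD1 c) //= eqxx big1 ?addr0 // => a /negbTE->.
exists P; last by rewrite mxE !eqxx -/p -/q -rE /=; ring.
apply/couplingP; split=> [a b|b|a].
- rewrite mxE.
  have := mu0 b; have := nu0 a; have := prob_vec_le1 b Hmu.
  have := prob_vec_le1 a Hnu.
  have [->|_] := eqVneq a a0; have [->|_] := eqVneq b b0.
  + rewrite -/p -/q /= => _ _ _ _.
    have -> : q * p - r * ((1 - q) * (1 - p)) = Num.max 0 (p + q - 1).
      by rewrite -rE; ring.
    by rewrite le_max lexx.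
  + rewrite -/q => _ ? ? ?.
    have -> : q * mu b 0 - r * ((1 - q) * (0 - mu b 0)) =
      q * mu b 0 + r * (1 - q) * mu b 0 by ring.
    by rewrite addr_ge0 ?mulr_ge0 ?subr_ge0.
  + rewrite -/p => ? ? ? _.
    have -> : nu a 0 * p - r * ((0 - nu a 0) * (1 - p)) =
      nu a 0 * p + r * (1 - p) * nu a 0 by ring.
    by rewrite addr_ge0 ?mulr_ge0 ?subr_ge0.
  + move=> ? ? ? ?.
    have -> : nu a 0 * mu b 0 - r * ((0 - nu a 0) * (0 - mu b 0)) =
      (1 - r) * (nu a 0 * mu b 0) by ring.
    by rewrite ?mulr_ge0 ?subr_ge0.
- under eq_bigr do rewrite mxE.
  by rewrite sumrB -mulr_suml nu1 -mulr_sumr -mulr_suml sumrB delta1 nu1; ring.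
- under eq_bigr do rewrite mxE.
  by rewrite sumrB -!mulr_sumr mu1 sumrB delta1 mu1; ring.
Qed.

End FrechetBound.

(** * Transport for a cost that separates except at one entry *)

Section Transport.
Variables (R : realType) (n : nat) (T : wtree R n).
Implicit Types (mu nu : 'cV[R]_n) (f g : 'I_n -> R).

(** For such a cost the marginals determine everything but the mass at
    [(a0, b0)].  The formula for the distance is required on the supports
    only, because a coupling vanishes elsewhere. *)
Lemma W1_separable_cost mu nu f g c a0 b0 :
  prob_vec mu -> prob_vec nu -> 0 <= c ->
  (forall a b, mu b 0 != 0 -> nu a 0 != 0 ->
     (dist T a b)%:R = f b + g a + c * ((a == a0) && (b == b0))%:R) ->
  W1 T mu nu = \sum_b mu b 0 * f b + \sum_a nu a 0 * g a
               + c * Num.max 0 (mu b0 0 + nu a0 0 - 1).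
Proof.
move=> Hmu Hnu c0 dE.
have costE P : coupling mu nu P ->
    \sum_a \sum_b P a b * (dist T a b)%:R =
    \sum_b mu b 0 * f b + \sum_a nu a 0 * g a + c * P a0 b0.
  move=> HP; have [P0 Pc Pr] := (couplingP mu nu P).1 HP.
  have -> : \sum_a \sum_b P a b * (dist T a b)%:R =
      \sum_a \sum_b (P a b * f b + P a b * g a
        + c * (P a b * ((a == a0) && (b == b0))%:R)).
    apply: eq_bigr => a _; apply: eq_bigr => b _.
    have [->|Pab] := eqVneq (P a b) 0; first by rewrite !mul0r mulr0 !addr0.
    by have [? ?] := coupling_supp HP Pab; rewrite dE //; ring.
  under eq_bigr do rewrite 2!big_split /=.
  rewrite 2!big_split /=; congr (_ + _ + _).
  - by rewrite exchange_big; apply: eq_bigr => b _; rewrite -mulr_suml Pc.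
  - by apply: eq_bigr => a _; rewrite -mulr_suml Pr.
  rewrite (bigD1 a0) //= [X in _ + X]big1 => [|a /negbTE na]; last first.
    by apply: big1 => b _; rewrite na /= !mulr0.
  rewrite (bigD1 b0) //= [X in _ + X + _]big1 => [|b /negbTE nb].
    by rewrite !eqxx mulr1 !addr0.
  by rewrite nb andbF !mulr0.
have [P HP PE] := coupling_entry_min a0 b0 Hmu Hnu.
rewrite /W1; set m := RHS; set E := (X in inf X).
have Em : E m by exists P => //; rewrite costE // PE.
have mE : lbound E m.
  move=> _ [Q HQ <-]; rewrite costE // lerD2l ler_wpM2l //.
  exact: coupling_entry_ge HQ.
apply/eqP; rewrite eq_le; apply/andP; split.
  by apply: ge_inf => //; exists m.
by apply: lb_le_inf => //; exists m.
Qed.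

End Transport.

(** * Lazy random walks *)

Section LazyWalk.
Variables (R : realType) (n : nat) (T : wtree R n) (alpha : R).
Hypotheses (alpha_ge0 : 0 <= alpha) (alpha_lt1 : alpha < 1).
Implicit Types (i j x : 'I_n) (f : 'I_n -> R).

(** A second vertex guarantees, by connectedness, that [i] has a neighbor. *)
Lemma wdeg_gt0 i j : i != j -> 0 < wdeg T i.
Proof.
move=> ij; have [z iz _] := closer_neighbor T ij.
rewrite /wdeg (bigD1 z) //= ltr_pwDl ?wgt_gt0 //.
by apply: sumr_ge0 => x /andP[ix _]; apply/ltW/wgt_gt0.
Qed.

Lemma lazy_walk_mean i f :
  \sum_x lazy_walk T alpha i x 0 * f x =
  alpha * f i + (1 - alpha) * \sum_(x | adj T i x) wgt T i x * f x / wdeg T i.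
Proof.
rewrite (bigD1 i) //= mxE eqxx; congr (_ + _).
rewrite mulr_sumr [RHS]big_mkcond [LHS]big_mkcond; apply: eq_bigr => x _.
rewrite mxE; have [->|_] /= := eqVneq x i; first by rewrite adj_irr.
by case: ifP => _; rewrite ?mul0r //; ring.
Qed.

Lemma prob_vec_lazy_walk i j : i != j -> prob_vec (lazy_walk T alpha i).
Proof.
move=> ij; have w0 := wdeg_gt0 ij; split=> [x|].
  rewrite mxE; case: ifP => // _; case: ifP => // ix.
  by rewrite divr_ge0 ?mulr_ge0 ?subr_ge0 ?(ltW (wgt_gt0 ix)) // ltW.
have := lazy_walk_mean i (fun=> 1).
under eq_bigr do rewrite mulr1; move=> ->.
under eq_bigr do rewrite mulr1.
by rewrite -mulr_suml divff ?gt_eqF //; ring.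
Qed.

Lemma lazy_walk_supp i x : lazy_walk T alpha i x 0 != 0 ->
  (x == i) || adj T i x.
Proof. by rewrite mxE; case: (x == i); case: (adj T i x); rewrite ?eqxx. Qed.

Lemma lazy_walk_mean_dist i j : i != j ->
  \sum_x lazy_walk T alpha i x 0 * (dist T x j)%:R =
  (dist T i j)%:R
  + (1 - alpha) * \sum_(x | adj T i x) wgt T i x * sigma T i j i x / wdeg T i.
Proof.
move=> ij; rewrite lazy_walk_mean.
have -> : \sum_(x | adj T i x) wgt T i x * (dist T x j)%:R / wdeg T i =
    (dist T i j)%:R
    + \sum_(x | adj T i x) wgt T i x * sigma T i j i x / wdeg T i.
  have w1 : \sum_(x | adj T i x) wgt T i x / wdeg T i = 1.
    by rewrite -mulr_suml divff // gt_eqF // (wdeg_gt0 ij).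
  rewrite -[X in X + _](mulr1 (dist T i j)%:R) -[X in _ * X + _]w1.
  rewrite mulr_sumr -big_split /=; apply: eq_bigr => x ix.
  by rewrite (dist_neighbor_sigma j ix); ring.
by ring.
Qed.

Lemma W1_lazy_walk i j : i != j ->
  W1 T (lazy_walk T alpha i) (lazy_walk T alpha j) =
  (dist T i j)%:R
  + (1 - alpha) *
      (\sum_(x | adj T i x) wgt T i x * sigma T i j i x / wdeg T i +
       \sum_(y | adj T j y) wgt T j y * sigma T i j j y / wdeg T j)
  + 2 * (adj T i j)%:R *
      Num.max 0 (lazy_walk T alpha i j 0 + lazy_walk T alpha j i 0 - 1).
Proof.
move=> ij; have ji : j != i by rewrite eq_sym.
have sC y : adj T j y -> wgt T j y * sigma T i j j y / wdeg T j =
    wgt T j y * sigma T j i j y / wdeg T j by move=> /sigmaC->.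
rewrite (@W1_separable_cost _ _ _ _ _ (fun b => (dist T b j)%:R)
   (fun a => (dist T a i)%:R - (dist T i j)%:R) (2 * (adj T i j)%:R) i j).
- have -> : \sum_a lazy_walk T alpha j a 0 *
        ((dist T a i)%:R - (dist T i j)%:R) =
      \sum_a lazy_walk T alpha j a 0 * (dist T a i)%:R - (dist T i j)%:R.
    under eq_bigr do rewrite mulrBr.
    by rewrite sumrB -mulr_suml (prob_vec_lazy_walk ji).2 mul1r.
  rewrite !lazy_walk_mean_dist // (distC T j i).
  rewrite [in RHS](eq_bigr _ sC); ring.
- exact: prob_vec_lazy_walk ij.
- exact: prob_vec_lazy_walk ji.
- by rewrite mulr_ge0 ?ler0n.
move=> a b /lazy_walk_supp ib /lazy_walk_supp ja.
have := dist_neighborhoods ij ib ja.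
case: (adj T i j); case: ((a == i) && (b == j)); rewrite /= ?muln1 ?addn0;
  by move/(congr1 (fun k => k%:R : R)); rewrite !natrD; lra.
Qed.

Lemma lazy_walk_neighbor_le i j : i != j ->
  lazy_walk T alpha i j 0 <= 1 - alpha.
Proof.
move=> ij; have [m0] := prob_vec_lazy_walk ij.
rewrite (bigD1 i) //= [X in X + _]mxE eqxx (bigD1 j) 1?eq_sym //=.
set S := \sum_(k | _) _; have : 0 <= S by apply: sumr_ge0.
by lra.
Qed.

End LazyWalk.

(** * The two endpoints of an edge *)

Section Edge.
Variables (R : realType) (n : nat) (T : wtree R n).
Implicit Types (i j x : 'I_n).

Lemma sigma_edge i j x : adj T i j -> adj T i x ->
  sigma T i j i x = if x == j then -1 else 1.
Proof.
move=> ij ix; have := dist_neighbor_sigma j ix; rewrite (dist_adj ij).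
case: eqP => [->|/eqP xj]; first by rewrite distii; lra.
have := dist_adjS j ix; have := dist_eq0 T x j.
rewrite (dist_adj ij) (negbTE xj) => x0 [->|[]]; first by lra.
by move/esym/eqP; rewrite x0.
Qed.

Lemma sum_sigma_edge (beta : R) i j : adj T i j ->
  beta * \sum_(x | adj T i x) wgt T i x * sigma T i j i x / wdeg T i =
  \sum_(x | adj T i x && (x != j)) wgt T i x * beta / wdeg T i
  - beta * wgt T i j / wdeg T i.
Proof.
move=> ij; rewrite mulr_sumr (bigD1 j) //= sigma_edge // eqxx addrC.
congr (_ + _); last by ring.
apply: eq_bigr => x /andP[ix xj].
by rewrite sigma_edge // (negbTE xj); ring.
Qed.

End Edge.

Theorem corollary3p3 (R : realType) (n : nat) (T : wtree R n) (i j : 'I_n)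
    (alpha : R) (neq_ij : i != j) (alpha_ge0 : 0 <= alpha)
    (alpha_lt1 : alpha < 1) :
  (adj T i j -> alpha < 1 / 2 ->
     or_curvature T alpha i j =
       1 - \sum_(x | adj T i x && (x != j)) wgt T i x * (1 - alpha) / wdeg T i
         - \sum_(y | adj T j y && (y != i)) wgt T j y * (1 - alpha) / wdeg T j
         - `|1 - (1 - alpha) * wgt T i j * (1 / wdeg T i + 1 / wdeg T j)|) /\
  (adj T i j -> 1 / 2 <= alpha ->
     or_curvature T alpha i j =
       - (1 - alpha) *
         (\sum_(x | adj T i x) wgt T i x * sigma T i j i x / wdeg T i +
          \sum_(y | adj T j y) wgt T j y * sigma T i j j y / wdeg T j)) /\
  (~~ adj T i j ->
     or_curvature T alpha i j =
       - ((1 - alpha) / (dist T i j)%:R) *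
         (\sum_(x | adj T i x) wgt T i x * sigma T i j i x / wdeg T i +
          \sum_(y | adj T j y) wgt T j y * sigma T i j j y / wdeg T j)).
Proof.
have neq_ji : j != i by rewrite eq_sym.
have W1E := W1_lazy_walk T alpha_ge0 alpha_lt1 neq_ij.
split; [|split] => [ij _|ij half|ij].
- have ji : adj T j i by rewrite adj_sym.
  rewrite /or_curvature W1E ij (dist_adj ij) mulrDr sum_sigma_edge //.
  have sC y : adj T j y -> wgt T j y * sigma T i j j y / wdeg T j =
      wgt T j y * sigma T j i j y / wdeg T j by move=> /sigmaC->.
  rewrite (eq_bigr _ sC) sum_sigma_edge // [wgt T j i]wgt_sym //.
  rewrite !mxE (negbTE neq_ji) (negbTE neq_ij) ij ji [wgt T j i]wgt_sym //.
  set P := (1 - alpha) * wgt T i j / wdeg T i.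
  set Q := (1 - alpha) * wgt T i j / wdeg T j.
  have -> : (1 - alpha) * wgt T i j * (1 / wdeg T i + 1 / wdeg T j) = P + Q.
    by rewrite /P /Q; ring.
  rewrite divr1 mulr1.
  have [PQ|PQ] := leP 0 (P + Q - 1).
    by rewrite ler0_norm; lra.
  by rewrite gtr0_norm; lra.
- rewrite /or_curvature W1E ij (dist_adj ij) max_l; last first.
    have := lazy_walk_neighbor_le T alpha_ge0 alpha_lt1 neq_ij.
    by have := lazy_walk_neighbor_le T alpha_ge0 alpha_lt1 neq_ji; lra.
  by rewrite mulr0 addr0 divr1; ring.
have d0 : (dist T i j)%:R != 0 :> R by rewrite pnatr_eq0 dist_eq0.
by rewrite /or_curvature W1E (negbTE ij) !mulr0 mul0r addr0; field.
Qed.
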